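(* Let $\lambda >0$ and, for integers $k\ge 0$, define $\pi(k)=e^{-\lambda} \frac{\lambda^k}{k!}$. Define $$ G(x) = x\, \mathbf{1}_{[0,1]}(x) + \exp\left\{\lambda \left(x + \left(1 + \frac{2}{x} \right) \log (\lambda x) \right) e^{x} \right\} \mathbf{1}_{(1,\infty)}(x), \qquad x > 0, $$ and $G(0)=0$. Then there exists a constant $c$ (depending only on $\lambda$) such that for any $f \colon \mathbb{N} \to \mathbb{R}$ with $f(0)=0$, it holds that $$ \log \left( \int e^f d\pi \right) \leq c + \int G(|\nabla f|)\, d\pi , $$ and a constant $d$ (depending only on $\lambda$) such that for every $f\colon\mathbb{N}\to\mathbb{R}$ with $\pi$-mean zero, i.e. $\int f\, d\pi=0$, the following holds: $$ \log \left( \int e^f d\pi \right) \leq c+d \int G(|\nabla f|)\, d\pi . $$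
   Context: $\mathbb{N}=\{0,1,2,\dots\}$; $\int g\,d\pi=\sum_{n=0}^\infty g(n)\pi(n)$; $\nabla f(k)=f(k+1)-f(k)$ for $k\in\mathbb{N}$. *)

(* Defs.v *)
From HB Require Import structures.
From mathcomp Require Import all_boot all_order all_algebra.
From mathcomp Require Import all_classical all_reals all_analysis.

Set Implicit Arguments.
Unset Strict Implicit.
Unset Printing Implicit Defensive.

Import Order.TTheory GRing.Theory Num.Theory.
Import numFieldNormedType.Exports.

Local Open Scope classical_set_scope.
Local Open Scope ring_scope.

(* The second argument of [poisson_prob] is not used by its definition; 0 is
   an arbitrary value. For 0 < lambda this is the measure with mass
   poisson_pmf lambda k = lambda ^+ k * k`!%:R^-1 * expR (- lambda) at k. *)
Definition poisson_measure (R : realType) (lambda : R) : probability nat R :=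
  poisson_prob lambda 0.

Definition G (R : realType) (lambda x : R) : R :=
  x * \1_`[0, 1] x +
  expR (lambda * (x + (1 + 2 / x) * ln (lambda * x)) * expR x) * \1_`]1, +oo[ x.

Definition nabla (R : realType) (f : nat -> R) (k : nat) : R := f k.+1 - f k.

(* Integrability is required because \int is a total operator. *)
Definition mean_zero (R : realType) (lambda : R) (f : nat -> R) : Prop :=
  (poisson_measure lambda).-integrable setT (fun k => (f k)%:E) /\
  (\int[poisson_measure lambda]_k (f k)%:E = 0)%E.

(* Main.v *)
(* Write T_k = pi(k) e^(f k) and g_k = G(|nabla f k|) pi(k), and consider
     Q_n = T_0 + ... + T_n + (n - 1) T_n.
   If lambda e^a <= (K_n + n - 1) exp(G(a) pi(n)) for all a >= 0, then
   Q_(n+1) <= (1 + K_n) e^(g_n) Q_n, and G grows so fast that K_n exists for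
   every n and can be taken to be 0 for n large.  Hence
   \int e^f dpi <= C exp(f 0 + \int G(|nabla f|) dpi).
   For f of mean zero, apply this to - f as well: e^(-f) >= 1 - f gives
   1 <= \int e^(-f) dpi, which bounds f 0 from above. *)
Require Import Defs.
From HB Require Import structures.
From mathcomp Require Import all_boot all_order all_algebra.
From mathcomp Require Import all_classical all_reals all_analysis.
From mathcomp Require Import measurable_realfun ring lra.
Import Order.TTheory GRing.Theory Num.Theory.
Import numFieldNormedType.Exports.
Local Open Scope classical_set_scope.
Local Open Scope ring_scope.

(** * Lower bounds on [G] and on the Poisson weights *)

Lemma G_ge0 {R : realType} (lambda x : R) : 0 <= G lambda x.
Proof.
rewrite /G !indicE; apply: addr_ge0; last by rewrite mulr_ge0 ?expR_ge0.
have [|_] := boolP (x \in `[0, 1]%classic); last by rewrite mulr0.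
by rewrite inE /= in_itv /= mulr1 => /andP[].
Qed.

(** For [1 <= lambda * a] the logarithm is nonnegative, so replacing 1 + 2/a by 1 only lowers the
    exponent. *)
Lemma G_lower_bound {R : realType} (lambda a : R) :
  0 < lambda -> 1 < a -> 1 <= lambda * a ->
  expR (lambda * expR a * (a + ln (lambda * a))) <= G lambda a.
Proof.
move=> l0 a1 la1; rewrite /G !indicE memNset; last first.
  by rewrite /= in_itv /=; apply/negP; rewrite negb_and -!ltNge a1 orbT.
rewrite mem_set; last by rewrite /= in_itv /= a1.
rewrite mulr0 add0r mulr1 ler_expR.
have ln0 : 0 <= ln (lambda * a) by exact: ln_ge0.
rewrite -mulrA [expR a * _]mulrC mulrA.
rewrite ler_pM2r ?expR_gt0// ler_pM2l// lerD2l mulrDl mul1r lerDl.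
by apply: mulr_ge0 => //; apply: divr_ge0; lra.
Qed.

Lemma poisson_pmfS {R : realType} (lambda : R) n : 0 < lambda ->
  poisson_pmf lambda n.+1 * n.+1%:R = lambda * poisson_pmf lambda n.
Proof.
move=> l0; rewrite /poisson_pmf l0 factS natrM invfM exprS.
by field; rewrite addrC natr1 !pnatr_eq0 -lt0n fact_gt0.
Qed.

Lemma poisson_pmf_gt0 {R : realType} (lambda : R) n : 0 < lambda ->
  0 < poisson_pmf lambda n.
Proof.
by move=> l0; rewrite /poisson_pmf l0 !mulr_gt0 ?exprn_gt0 ?expR_gt0 ?invr_gt0
  ?ltr0n ?fact_gt0.
Qed.

(** Provides K_n for each fixed n: with p = pi(n), exponentiating gives lambda e^a <= lambda e^M
    e^(G(a) p). For large a it follows from G(a) >= e^a. *)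
Lemma id_le_affine_G {R : realType} (lambda p : R) : 0 < lambda -> 0 < p ->
  exists2 M, 0 <= M & forall a, 0 <= a -> a <= M + G lambda a * p.
Proof.
move=> l0 p0; have li0 : 0 < lambda^-1 by rewrite invr_gt0.
have pi0 : 0 < 4 / p by rewrite divr_gt0.
(* For a > M the three summands give a > 1, lambda a >= 1 and a^2 / 4 >= a / p. *)
exists (2 + lambda^-1 + 4 / p) => [|a a0]; first lra.
have Gp : 0 <= G lambda a * p by rewrite mulr_ge0 ?G_ge0 ?ltW.
have [|aM] := leP a (2 + lambda^-1 + 4 / p); first lra.
have la1 : 1 <= lambda * a by rewrite mulrC -ler_pdivrMr// div1r; lra.
apply: (@le_trans _ _ (G lambda a * p)); last lra.
rewrite -ler_pdivrMr//; have a1 : 1 < a by lra.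
apply: le_trans (G_lower_bound _ _ l0 a1 la1).
have ea := expR_ge1Dx a; have lna := ln_ge0 la1.
apply: (@le_trans _ _ (expR a)); last first.
  rewrite ler_expR [lambda * _]mulrC -mulrA mulrDr.
  have : 0 <= lambda * ln (lambda * a) by rewrite mulr_ge0 // ltW.
  by move: (expR a) ea => e ea ?; nra.
have e2 := expR_ge1Dx (a / 2).
have -> : expR a = expR (a / 2) * expR (a / 2) by rewrite -expRD; congr expR; lra.
apply: (@le_trans _ _ ((a / 2) * (a / 2))); last by apply: ler_pM; lra.
have -> : p^-1 = 4 / p / 4 by field; rewrite gt_eqF.
by move: (4 / p) pi0 aM => q q0 aM; nra.
Qed.

(** A crude substitute for Stirling: n + 1 <= 2^n and n! <= n^n. *)
Lemma leq_factS_exp (n : nat) : (n.+1`! <= 2 ^ n * n ^ n)%N.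
Proof.
rewrite factS leq_mul//; first exact: ltn_expl.
elim: n => // n IH; rewrite factS expnS leq_mul// (leq_trans IH)//.
by case: n {IH} => // n; rewrite leq_exp2r.
Qed.

Lemma poisson_pmfS_lower_bound {R : realType} (lambda : R) m :
  0 < lambda -> (0 < m)%N ->
  expR (m.+1%:R * ln lambda - m%:R - m%:R * ln m%:R - lambda) <=
  poisson_pmf lambda m.+1.
Proof.
move=> l0 m0; rewrite /poisson_pmf l0 expRB ler_pdivrMr ?expR_gt0//.
rewrite [expR (- lambda)]expRN divfK ?gt_eqF ?expR_gt0// 2!expRB expRM_natl lnK ?posrE//.
rewrite -mulrA ler_pM2l ?exprn_gt0// -invfM.
rewrite lef_pV2 ?posrE ?mulr_gt0 ?expR_gt0 ?ltr0n ?fact_gt0//.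
have /le_trans : (m.+1`!%:R : R) <= (2 ^ m * m ^ m)%:R.
  by rewrite ler_nat leq_factS_exp.
apply; rewrite natrM !natrX expRM_natl lnK ?posrE ?ltr0n//.
(* Since 2 <= e, the factor 2^m is absorbed by e^m. *)
rewrite ler_wpM2r// -[X in expR X]mulr1 expRM_natl.
by rewrite lerXn2r ?nnegrE ?expR_ge0//; have := expR_ge1Dx (1 : R); lra.
Qed.

(* If x = lambda e^a > m, then G(a) >= e^(x (ln x + ln a)), while
   1 / pi(m + 1) is e^(m ln m + O(m)); since x ln x >= m ln m, the factor
   e^(x ln a) with a large absorbs the O(m). *)
Lemma expR_le_expR_G {R : realType} (lambda : R) : 0 < lambda ->
  exists N, forall m a, (N <= m)%N -> 0 <= a ->
    lambda * expR a <= m%:R * expR (G lambda a * poisson_pmf lambda m.+1).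
Proof.
(* With x = lambda e^a, the product x B covers x + m + lambda + (m + 1) L in the final estimate. For
   a > A one has a > 1, lambda a >= 1 and ln a >= B. *)
move=> l0; set L := `|ln lambda|; set B := 2 + lambda + 2 * L.
set A := 2 + lambda^-1 + expR B.
have li0 : 0 < lambda^-1 by rewrite invr_gt0.
have L0 : 0 <= L := normr_ge0 _.
have leA0 : 0 <= lambda * expR A by rewrite mulr_ge0 ?expR_ge0 ?ltW.
(* This N forces a > A as soon as lambda e^a > m; the successor gives m >= 1. *)
exists (Num.bound (lambda * expR A)).+1 => m a Nm a0.
have m1 : (1 : R) <= m%:R by rewrite ler1n; apply: leq_trans Nm.
have p0 := poisson_pmf_gt0 lambda m.+1 l0.
set g := G lambda a * _.
have g0 : 0 <= g by rewrite mulr_ge0 ?G_ge0 ?ltW.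
have eg := expR_ge1Dx g.
have [xm|mx] := leP (lambda * expR a) m%:R; first by nra.
have Am : lambda * expR A < m%:R.
  by rewrite (lt_le_trans (archi_boundP leA0))// ler_nat ltnW.
have Aa : A < a.
  by rewrite -ltr_expR -(ltr_pM2l l0) (lt_trans Am).
have eB := expR_gt0 B.
have a1 : 1 < a by rewrite /A in Aa; lra.
have la1 : 1 <= lambda * a.
  by rewrite mulrC -ler_pdivrMr// div1r; rewrite /A in Aa; lra.
set x := lambda * expR a in mx *.
have x0 : 0 < x by lra.
suff xg : x <= g by nra.
have xe := expR_ge1Dx x.
apply: (@le_trans _ _ (expR x)); first lra.
have pm : (0 < m)%N by apply: leq_trans Nm.
apply: (@le_trans _ _ (expR (x * (a + ln (lambda * a))) *
  expR (m.+1%:R * ln lambda - m%:R - m%:R * ln m%:R - lambda))); last first.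
  apply: ler_pM; rewrite ?expR_ge0//; first exact: G_lower_bound.
  exact: poisson_pmfS_lower_bound.
have apos : 0 < a by lra.
have lnx : ln x = ln lambda + a by rewrite lnM ?posrE ?expR_gt0// expRK.
have Blna : B <= ln a.
  rewrite -[B]expRK ler_ln ?posrE// ltW// (le_lt_trans _ Aa)// /A; lra.
have lnmx : ln m%:R <= ln x by rewrite ler_ln ?posrE//; lra.
have lnm0 : 0 <= ln (m%:R : R) by exact: ln_ge0.
have -> : a + ln (lambda * a) = ln x + ln a by rewrite lnM ?posrE// lnx; lra.
rewrite -expRD ler_expR -natr1.
have xlnx : m%:R * ln m%:R <= x * ln x by apply: ler_pM; lra.
have xlna : x * B <= x * ln a by rewrite ler_pM2l.
have Lln : - L <= ln lambda by rewrite lerNl -[L]normrN ler_norm.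
have mL : (m%:R + 1) * - L <= (m%:R + 1) * ln lambda by rewrite ler_pM2l//; lra.
have xL : m%:R * L <= x * L by rewrite ler_wpM2r// ltW.
have xL1 : 1 * L <= x * L by rewrite ler_wpM2r//; lra.
have xl : 1 * lambda <= x * lambda by rewrite ler_pM2r//; lra.
rewrite /B in xlna; lra.
Qed.

(** * Growth of Q_n *)

Definition expmass {R : realType} (lambda : R) (f : nat -> R) k :=
  poisson_pmf lambda k * expR (f k).

(* The weight n - 1 makes Q_(n+1) = T_0 + ... + T_n + (n + 1) T_(n+1), where
   (n + 1) T_(n+1) = lambda e^(nabla f n) T_n. *)
Definition lyapunov {R : realType} (lambda : R) (f : nat -> R) n :=
  \sum_(k < n.+1) expmass lambda f k + n.-1%:R * expmass lambda f n.

Lemma expmass_gt0 {R : realType} (lambda : R) f k : 0 < lambda ->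
  0 < expmass lambda f k.
Proof. by move=> l0; rewrite mulr_gt0 ?expR_gt0 ?poisson_pmf_gt0. Qed.

Lemma lyapunovS {R : realType} (lambda K : R) (f : nat -> R) n :
  0 < lambda -> 0 <= K ->
  (forall a, 0 <= a ->
    lambda * expR a <= (K + n.-1%:R) * expR (G lambda a * poisson_pmf lambda n)) ->
  lyapunov lambda f n.+1 <=
  (1 + K) * expR (G lambda `|nabla f n| * poisson_pmf lambda n) *
  lyapunov lambda f n.
Proof.
move=> l0 K0 H; rewrite /lyapunov; set T := expmass lambda f.
have T0 k : 0 < T k by exact: expmass_gt0.
have p0 := poisson_pmf_gt0 lambda n l0.
have {H} := H _ (normr_ge0 (nabla f n)).
set g := G _ _ * _ => H.
have g0 : 0 <= g by rewrite mulr_ge0 ?G_ge0 ?ltW.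
have eg := expR_ge1Dx g.
have TS : n.+1%:R * T n.+1 <= lambda * expR `|nabla f n| * T n.
  rewrite /T /expmass mulrA [n.+1%:R * _]mulrC poisson_pmfS// -!mulrA ler_pM2l//.
  rewrite mulrCA ler_pM2l// -expRD ler_expR -lerBlDr.
  exact: ler_norm.
have TS' : lambda * expR `|nabla f n| * T n <=
  (K + n.-1%:R) * expR g * T n by rewrite ler_pM2r.
have -> : \sum_(k < n.+2) T k + n.+1.-1%:R * T n.+1 =
    \sum_(k < n.+1) T k + n.+1%:R * T n.+1.
  by rewrite big_ord_recr /= -natr1 mulrDl mul1r -addrA [T _ + _]addrC.
have TleS : T n <= \sum_(k < n.+1) T k.
  by rewrite big_ord_recr/= lerDr sumr_ge0// => k _; rewrite ltW.
move: (\sum_(k < n.+1) T k) TleS => S TleS.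
have n0 : (0 : R) <= n.-1%:R by [].
have Tn := T0 n.
apply: (@le_trans _ _ ((K + n.-1%:R) * expR g * T n + S)); first lra.
rewrite -subr_ge0.
(* Each summand is nonnegative because e^g >= 1 and S >= T_n. *)
have -> : (1 + K) * expR g * (S + n.-1%:R * T n) - ((K + n.-1%:R) * expR g * T n + S)
   = (expR g - 1) * S + K * expR g * (S - T n) + K * expR g * n.-1%:R * T n.
  ring.
by rewrite !addr_ge0// !mulr_ge0 ?expR_ge0 ?subr_ge0//; lra.
Qed.

Definition Gsum {R : realType} (lambda : R) (f : nat -> R) n :=
  \sum_(k < n) G lambda `|nabla f k| * poisson_pmf lambda k.

(** By induction, C is pi(0) times the factors 1 + K_k for k < n: independent of f, but possibly
    growing with n. *)
Lemma lyapunov_bound {R : realType} (lambda : R) n : 0 < lambda ->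
  exists2 C, 0 < C & forall f,
    lyapunov lambda f n <= C * expR (f 0%N + Gsum lambda f n).
Proof.
move=> l0; elim: n => [|n [C C0 IH]].
  (* Since [0.-1] is 0, Q_0 = T_0 = pi(0) e^(f 0). *)
  exists (poisson_pmf lambda 0); first exact: poisson_pmf_gt0.
  by move=> f; rewrite /lyapunov /Gsum big_ord0 big_ord1 mul0r !addr0.
have p0 := poisson_pmf_gt0 lambda n l0.
have [M M0 HM] := id_le_affine_G lambda _ l0 p0.
have K0 : 0 <= lambda * expR M by rewrite mulr_ge0 ?expR_ge0 ?ltW.
exists ((1 + lambda * expR M) * C) => [|f]; first by rewrite mulr_gt0//; lra.
have S := lyapunovS _ _ f n l0 K0.
apply: (le_trans (S _)) => [a a0|].
  rewrite mulrDl -[leLHS]addr0 lerD ?mulr_ge0 ?expR_ge0//.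
  by rewrite -mulrA -expRD ler_pM2l// ler_expR HM.
rewrite /Gsum big_ord_recr/= addrA expRD !mulrA mulrAC ler_pM2r ?expR_gt0//.
by rewrite -!mulrA ler_pM2l//; lra.
Qed.

(** From rank N + 1 on, K = 0 is allowed, so the constant C reached there serves all larger n. *)
Lemma lyapunov_ubound {R : realType} (lambda : R) : 0 < lambda ->
  exists2 C, 0 < C & exists N, forall f n, (N <= n)%N ->
    lyapunov lambda f n <= C * expR (f 0%N + Gsum lambda f n).
Proof.
move=> l0; have [N HN] := expR_le_expR_G _ l0.
have [C C0 HC] := lyapunov_bound _ N.+1 l0.
exists C => //; exists N.+1 => f; elim=> // n IH.
rewrite leq_eqVlt => /predU1P[<-//|Nn]; have {}IH := IH Nn.
apply: (le_trans (lyapunovS _ 0 f n l0 _ _)) => // [a a0|].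
  (* Here n = m + 1 with m >= N, matching the index shift in [expR_le_expR_G]. *)
  by case: n Nn {IH} => // n Nn; rewrite add0r HN.
rewrite addr0 mul1r /Gsum big_ord_recr/= addrA expRD mulrA mulrC.
by rewrite ler_pM2r ?expR_gt0.
Qed.

(** * Integrals against the Poisson measure *)

Lemma integral_nat {R : realType} (mu : {measure set nat -> \bar R})
  (f : nat -> \bar R) : (forall k, 0 <= f k)%E ->
  (\int[mu]_k f k = \sum_(0 <= k <oo) (f k * mu [set k]))%E.
Proof.
move=> f0; have -> : [set: nat] = \bigcup_k [set k].
  by apply/seteqP; split => // k _; exists k.
rewrite ge0_integral_bigcup//; last by move=> i j _ _ [x [-> ->]].
apply: eq_eseriesr => k _; rewrite -integral_cst//.
by apply: eq_integral => j; rewrite inE => ->.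
Qed.

Lemma integral_poisson {R : realType} (lambda : R) (f : nat -> R) :
  0 < lambda -> (forall k, 0 <= f k) ->
  (\int[poisson_measure lambda]_k (f k)%:E =
   \sum_(0 <= k <oo) (f k * poisson_pmf lambda k)%:E)%E.
Proof.
move=> l0 f0; rewrite integral_nat//; apply: eq_eseriesr => k _.
rewrite /poisson_measure/= /poisson_prob l0 esum_set1 ?EFinM//.
by rewrite lee_fin poisson_pmf_ge0.
Qed.

(** The partial sum T_0 + ... + T_n is at most Q_n, which is bounded uniformly in large n because
    [Gsum] is at most I. A real I suffices: an infinite integral of G makes the final bounds
    trivial. *)
Lemma integral_expR_le {R : realType} (lambda : R) : 0 < lambda ->
  exists2 c : R, 0 <= c & forall (f : nat -> R) (I : R),
    (\int[poisson_measure lambda]_k (G lambda `|nabla f k|%R)%:E = I%:E)%E ->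
    (\int[poisson_measure lambda]_k (expR (f k))%:E <= (expR (f 0%N + c + I))%:E)%E.
Proof.
move=> l0; have [C C0 [N HN]] := lyapunov_ubound _ l0.
(* The absolute value makes c nonnegative, so that 2c can later replace c. *)
exists `|ln C| => // f I.
have G0 k : 0 <= G lambda `|nabla f k| by exact: G_ge0.
rewrite !integral_poisson// => GI.
have p0 k : 0 <= poisson_pmf lambda k by exact: poisson_pmf_ge0.
have Gn n : Gsum lambda f n <= I.
  rewrite -lee_fin -GI /Gsum -(big_mkord xpredT
    (fun k => G lambda `|nabla f k| * poisson_pmf lambda k)) -sumEFin.
  by apply: nneseries_lim_ge => k _ _; rewrite lee_fin mulr_ge0.
apply: lime_le.
  by apply: is_cvg_nneseries => k _ _; rewrite lee_fin mulr_ge0 ?expR_ge0.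
exists N.+1 => // -[//|n] /= Nn; rewrite sumEFin lee_fin big_mkord.
apply: (@le_trans _ _ (lyapunov lambda f n)).
  rewrite /lyapunov -[leLHS]addr0 lerD ?mulr_ge0 ?expR_ge0 ?p0//.
  by apply: ler_sum => k _; rewrite mulrC.
apply: (le_trans (HN _ _ Nn)); rewrite -[C]lnK ?posrE// -expRD ler_expR.
rewrite expRK; have := ler_norm (ln C); have := Gn n; lra.
Qed.

(** * Functions of mean zero, and the conclusion *)

Lemma nablaN {R : realType} (f : nat -> R) k : nabla (fun k => - f k) k = - nabla f k.
Proof. by rewrite /nabla opprB opprK addrC. Qed.

(** A case of Jensen's inequality, from integrating e^(-t) >= 1 - t. *)
Lemma integral_expRN_ge1 {d : measure_display} {T : measurableType d}
  {R : realType} (P : probability T R) (f : T -> R) :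
  P.-integrable setT (fun x => (f x)%:E) -> (\int[P]_x (f x)%:E = 0)%E ->
  (1 <= \int[P]_x (expR (- f x))%:E)%E.
Proof.
move=> fi f0.
have mf : measurable_fun setT f by apply/measurable_EFinP; exact: measurable_int fi.
have me : measurable_fun setT (EFin \o (fun x => expR (- f x))).
  by apply/measurable_EFinP; apply: measurableT_comp => //; exact: measurableT_comp.
(* An infinite integral is trivially at least 1; a finite one makes e^(-f) integrable, as
   [le_integral] requires. *)
have [|] := boolP (\int[P]_x (expR (- f x))%:E < +oo)%E; last first.
  by rewrite -leNgt leye_eq => /eqP ->; rewrite leey.
move=> fin; have ei : P.-integrable setT (fun x => (expR (- f x))%:E).
  apply/integrableP; split => //; rewrite (eq_integral (fun x => (expR (- f x))%:E))//.
  by move=> x _; rewrite gee0_abs// lee_fin expR_ge0.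
have ci : P.-integrable setT (cst 1%E) by exact: finite_measure_integrable_cst.
have -> : (1 = \int[P]_x (cst 1 x - (f x)%:E))%E.
  by rewrite integralB// integral_cst// f0 mul1e sube0; exact/esym/probability_setT.
apply: le_integral => //; first exact: integrableB.
by move=> x _; rewrite /= -EFinB lee_fin expR_ge1Dx.
Qed.

Theorem theorem5p2 (R : realType) (lambda : R) (hlambda : 0 < lambda) :
  exists c : R,
    (forall f : nat -> R, f 0%N = 0 ->
      (lne (\int[poisson_measure lambda]_k (expR (f k))%:E) <=
       c%:E + \int[poisson_measure lambda]_k (G lambda `|nabla f k|%R)%:E)%E) /\
    exists d : R, forall f : nat -> R, mean_zero lambda f ->
      (lne (\int[poisson_measure lambda]_k (expR (f k))%:E) <=
       c%:E + d%:E * \int[poisson_measure lambda]_k (G lambda `|nabla f k|%R)%:E)%E.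
Proof.
have [c c0 H] := integral_expR_le _ hlambda.
have lneP (f : nat -> R) (r : R) :
    (\int[poisson_measure lambda]_k (expR (f k))%:E <= (expR r)%:E)%E ->
    (lne (\int[poisson_measure lambda]_k (expR (f k))%:E) <= r%:E)%E.
  rewrite -[(expR r)%:E]/(expeR r%:E) => fr; rewrite -lee_expeR lneK//.
  by rewrite in_itv /= leey andbT integral_ge0// => k _; rewrite lee_fin expR_ge0.
have I0 (f : nat -> R) :
    (0 <= \int[poisson_measure lambda]_k (G lambda `|nabla f k|%R)%:E)%E.
  by apply: integral_ge0 => k _; rewrite lee_fin G_ge0.
(* For mean zero, the exponent f 0 + c + I with f 0 <= c + I is at most 2c + 2I: hence c + c here
   and d = 2 below. *)
exists (c + c); split => [f f0|].
  case E : (integral _ _ _) (I0 f) => [I| |]// _; last by rewrite addey ?leey.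
  by apply: lneP; apply: (le_trans (H _ _ E)); rewrite lee_fin ler_expR f0; lra.
exists 2 => f fz.
case E : (integral _ _ _) (I0 f) => [I| |]// _; last first.
  by rewrite gt0_muley ?lte_fin// addey ?leey.
have EN : (\int[poisson_measure lambda]_k
    (G lambda `|nabla (fun k => (- f k)%R) k|%R)%:E = I%:E)%E.
  by rewrite -E; apply: eq_integral => k _; rewrite nablaN normrN.
(* The bound for - f reads 1 <= e^(- f 0 + c + I), that is, f 0 <= c + I. *)
have [fi f0] := fz; have := le_trans (integral_expRN_ge1 _ _ fi f0) (H _ _ EN).
rewrite lee_fin -[leLHS]expR0 ler_expR => f0c.
by apply: lneP; apply: (le_trans (H _ _ E)); rewrite lee_fin ler_expR; lra.
Qed.
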